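(* Let $(X,\|\cdot\|)$ be a Banach space and $K\subset X$ a cone. Let $r_1,r_2,R$ be positive numbers with $r_i\le R$ ($i=1,2$) and $r_1\neq r_2$, and let $T:\overline{B}(0,R)\cap K\to K$ be a mapping (not necessarily continuous) such that $T(\overline{B}(0,R)\cap K)$ is relatively compact and $$\{x\}\cap\mathbb{T}x\subset\{Tx\}\quad\text{for all }x\in\overline{B}(0,R)\cap K,$$ where $\mathbb{T}$ is the closed--convex envelope of $T$. Suppose that (a) $\lambda x\notin\mathbb{T}x$ for all $x\in K$ with $\|x\|=r_1$ and all $\lambda\ge 1$; (b) there exists $w\in K$ with $\|w\|\ne 0$ such that $x\notin\mathbb{T}x+\lambda w$ for all $\lambda\ge 0$ and all $x\in K$ with $\|x\|=r_2$. Then $T$ has at least one fixed point $x\in K$ with $\min\{r_1,r_2\}<\|x\|<\max\{r_1,r_2\}$.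
   Context: A cone in a Banach space $X$ is a closed convex set $K$ such that $\lambda x\in K$ for all $x\in K$, $\lambda\ge 0$, and such that $x\in K$, $-x\in K$ imply $x=0$. For $D=\overline{B}(0,R)\cap K$ (with $\overline B(0,R)$ the closed ball of radius $R$ centered at $0$), the closed--convex envelope of $T:D\to K$ is the multivalued map $\mathbb{T}:D\to 2^K$, $\mathbb{T}x=\bigcap_{\varepsilon>0}\overline{\mathrm{co}}\,T\big(\overline{B}_\varepsilon(x)\cap D\big)$, where $\overline B_\varepsilon(x)$ is the closed ball of center $x$ and radius $\varepsilon$ and $\overline{\mathrm{co}}$ denotes closed convex hull. $\mathbb{T}x+\lambda w$ denotes the set $\{y+\lambda w: y\in\mathbb Tx\}$. *)

(* Defs.v *)
From HB Require Import structures.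
From mathcomp Require Import all_boot all_order all_algebra.
From mathcomp Require Import all_classical all_reals all_analysis.
Set Implicit Arguments. Unset Strict Implicit. Unset Printing Implicit Defensive.
Import Order.TTheory GRing.Theory Num.Theory.
Import numFieldNormedType.Exports.
Local Open Scope classical_set_scope.
Local Open Scope ring_scope.

Section Defs.
Variables (R : realType) (X : completeNormedModType R).

Definition cball (x : X) (e : R) : set X := [set y | `|y - x| <= e].

Definition is_convex (A : set X) : Prop :=
  forall x y (t : R), A x -> A y -> 0 <= t -> t <= 1 -> A (t *: x + (1 - t) *: y).

Definition is_cone (K : set X) : Prop :=
  [/\ closed K, is_convex K,
      (forall x (l : R), K x -> 0 <= l -> K (l *: x)) &
      (forall x, K x -> K (- x) -> x = 0)].

Definition clco (A : set X) : set X :=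
  [set z | forall C : set X, closed C -> is_convex C -> A `<=` C -> C z].

Definition envelope (K : set X) (Rad : R) (T : X -> X) (x : X) : set X :=
  [set y | forall eps : R, 0 < eps ->
     clco (T @` (cball x eps `&` (cball 0 Rad `&` K))) y].
End Defs.

(* Main.v *)
Require Import Defs.
From HB Require Import structures.
From mathcomp Require Import all_boot all_order all_algebra.
From mathcomp Require Import all_classical all_reals all_analysis.
From mathcomp Require Import zify ring lra.
Import Order.TTheory GRing.Theory Num.Theory.
Import numFieldNormedType.Exports.

(** Let [rho < sg] be the two radii and let [p] be a continuous function of the
radius equal to [r2] below [rho] and to [r1] above [sg], with values strictly
between them in between. With [u x = (p `|x| / `|x|) x] put
[g x = (min `|x| sg / p `|x|) T (u x) + max 0 (rho - `|x|) w]. A fixed point of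
the envelope of [g] gives a point of the envelope of [T] at [u x]; it contradicts
(b) if [`|x| <= rho] and (a) if [sg <= `|x|], and otherwise it says that [u x]
lies in the envelope of [T] at [u x]. Since [p] may be decreasing, the compressive
and the expansive case are treated at once, and no fixed point index is needed.

The map [g] sends [K] into a compact set [C], and it remains to see that such a
map, continuous or not, has a fixed point of its envelope. Given an [e]-net
[v_i] of the (compact) closed convex hull of [C], a Schauder projection reduces
this to the Knaster-Kuratowski-Mazurkiewicz lemma on the simplex spanned by the
[g v_i], and compactness allows [e] to tend to 0. The KKM lemma is in turn
obtained from Scarf's parity argument on dominant sets, which needs no
triangulation. *)

(** * Scarf's dominant sets in a finite family of linear orders *)

Section Combinatorics.
Set Implicit Arguments. Unset Strict Implicit.
(* The names of these two files are shadowed by those of [all_classical]. *)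
Import mathcomp.boot.fintype mathcomp.boot.finset.

(** Removing either point of a coincidence keeps the image, and what is left has as many points as
    the image. This serves twice: for the minima of a dominant set and for the labels of a room. *)
Lemma almost_inj_on (A B : finType) (f : A -> B) (D : {set A}) :
  #|D| = #|f @: D|.+1 ->
  exists a b, [/\ [/\ a \in D, b \in D, a != b & f a = f b],
    {in D :\ a &, injective f} & {in D :\ b &, injective f}].
Proof.
move=> cD.
have [a [b [aD bD ab fab]]] : exists a b, [/\ a \in D, b \in D, a != b & f a = f b].
  have : ~~ [forall a in D, forall b in D, (f a == f b) ==> (a == b)].
    apply/negP => /forall_inP H.
    have : {in D &, injective f}.
      move=> a b aD bD fab; apply/eqP.
      by move/forall_inP: (H _ aD) => /(_ _ bD); rewrite fab eqxx.
    by move/card_in_imset => E; move: cD; rewrite E; lia.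
  case/forall_inPn => a aD /forall_inPn[b bD].
  by rewrite negb_imply => /andP[/eqP ? ?]; exists a, b.
have inj_rm z t : z \in D -> t \in D -> z != t -> f z = f t ->
    {in D :\ z &, injective f}.
  move=> zD tD zt fzt; apply/imset_injP.
  suff -> : f @: (D :\ z) = f @: D by move: cD; rewrite (cardsD1 z) zD; lia.
  apply/eqP; rewrite eqEsubset imsetS ?subsetDl //=.
  apply/subsetP => _ /imsetP[v vD ->]; have [->|vz] := eqVneq v z.
    by rewrite fzt; apply: imset_f; rewrite !inE eq_sym zt.
  by apply: imset_f; rewrite !inE vz.
exists a, b; split => //; first exact: inj_rm ab fab.
by apply: (inj_rm b a) => //; rewrite eq_sym.
Qed.

Section Dominant.
Variables (I Y : finType) (rk : I -> Y -> nat).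
Hypothesis rk_inj : forall i, injective (rk i).

(** Scarf's dominance: for nonempty [s], no element of [Y] lies strictly above the minimum of [s] in
    all orders at once. *)
Definition dominant (s : {set Y}) :=
  [forall y, exists i, [forall x in s, rk i y <= rk i x]].

Lemma dominantP (s : {set Y}) :
  reflect (forall y, exists i, forall x, x \in s -> rk i y <= rk i x) (dominant s).
Proof.
apply: (iffP forallP) => H y.
  by have /existsP[i /forall_inP Hi] := H y; exists i.
by have [i Hi] := H y; apply/existsP; exists i; apply/forall_inP.
Qed.

Lemma dominantS (s t : {set Y}) : s \subset t -> dominant t -> dominant s.
Proof.
move=> /subsetP st /dominantP ht; apply/dominantP => y.
by have [i hi] := ht y; exists i => x /st; exact: hi.
Qed.

(** With [m] the minima of [s], adding such an element to [s] can change the minimum in the order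
    [l] only. *)
Definition above (m : I -> Y) l :=
  [set y | [forall i, (i != l) ==> (rk i (m i) < rk i y)]].

(* If [m i] is the least element of [s] in the order [i], exactly two orders [j]
   and [k] have the same one; the dominant extensions of [s] are obtained by
   adding the greatest element, for [j], of [above m j], or likewise for [k]. *)
Lemma dominant_extensions (s : {set Y}) (m : I -> Y) :
  dominant s -> #|s|.+1 = #|I| ->
  (forall i, m i \in s) -> (forall i x, x \in s -> rk i (m i) <= rk i x) ->
  exists j k, [/\ j != k, m j = m k &
    #|[set y | (y \notin s) && dominant (y |: s)]|
      = (above m j != set0) + (above m k != set0)].
Proof.
move=> /dominantP ds cs ms mmin.
have mE i x : x \in s -> (forall z, z \in s -> rk i x <= rk i z) -> m i = x.
  move=> xs hx; apply: (@rk_inj i); apply/eqP.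
  by rewrite eqn_leq mmin // hx.
(* Dominance applied to a point of [s] itself makes it the minimum in some order; [m] is thus onto
   [s], and the cardinalities leave room for a single coincidence. *)
have im : m @: setT = s.
  apply/eqP; rewrite eqEsubset; apply/andP; split.
    by apply/subsetP => _ /imsetP[i _ ->].
  apply/subsetP => x xs; have [i hi] := ds x.
  by rewrite -(mE i x) // imset_f.
have [|j [k [[_ _ jk mjk] injj injk]]] := @almost_inj_on I Y m setT.
  by rewrite im cs cardsT.
exists j, k; split => //.
pose M := above m; rewrite -/(M j) -/(M k).
have M_P l y : reflect (forall i, i != l -> rk i (m i) < rk i y) (y \in M l).
  rewrite inE; apply: (iffP forallP) => H i; first by move=> il; have := H i; rewrite il.
  by apply/implyP; exact: H.
have same i : m i = m j -> i = j \/ i = k.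
  move=> mij; have [->|ij] := eqVneq i j; first by left.
  right; apply: injj; rewrite ?inE ?ij //; last by rewrite mij.
  by rewrite eq_sym jk.
have inj_out i i' : i != j -> i != k -> m i' = m i -> i' = i.
  move=> ij ik mi; have [i'j|i'j] := eqVneq i' j.
    by apply: injk; rewrite ?inE ?ik // i'j jk.
  by apply: injj; rewrite ?inE ?ij ?i'j.
(* A common element would exceed the minimum of [s] in every order. *)
have Mdisj y : y \in M j -> y \in M k -> False.
  move=> /M_P yj /M_P yk; have [i hi] := ds y.
  have : rk i (m i) < rk i y.
    have [ij|ij] := eqVneq i j; last exact: yj.
    by apply: yk; rewrite ij.
  by rewrite ltnNge hi.
have Mnots l y : (l = j) \/ (l = k) -> y \in M l -> y \notin s.
  move=> hl /M_P yl; apply/negP; rewrite -im => /imsetP[i _ yi].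
  have [l' [l'l ml']] : exists l', l' != l /\ m l' = y.
    have [il|il] := eqVneq i l; last by exists i.
    case: hl => hl; [exists k|exists j]; split; rewrite ?hl //.
    - by rewrite eq_sym.
    - by rewrite -mjk -hl -il.
    - by rewrite mjk -hl -il.
  by have := yl _ l'l; rewrite ml' ltnn.
pose ismax l y := (y \in M l) && [forall z in M l, rk l z <= rk l y].
have card_max l : #|[set y | ismax l y]| = (M l != set0).
  have [M0|[z0 z0M]] := set_0Vmem (M l).
    rewrite M0 eqxx; apply/eqP; rewrite cards_eq0; apply/eqP/setP => y.
    by rewrite !inE /ismax M0 inE.
  have -> : M l != set0 by apply/set0Pn; exists z0.
  case: (arg_maxnP (rk l) z0M) => y yM ymax.
  apply/eqP/cards1P; exists y; apply/setP => z; rewrite !inE /ismax.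
  apply/andP/eqP => [[zM /forall_inP zmax]|->].
    by apply: (@rk_inj l); apply/eqP; rewrite eqn_leq zmax // andbT; exact: ymax.
  by split => //; apply/forall_inP => t; exact: ymax.
rewrite -!card_max -cardsUI.
have -> : [set y | ismax j y] :&: [set y | ismax k y] = set0.
  apply/setP => y; rewrite !inE /ismax; apply/negP.
  by move=> /andP[/andP[yj _] /andP[yk _]]; exact: Mdisj yj yk.
rewrite cards0 addn0; congr #|pred_of_set _|; apply/setP => y; rewrite !inE.
have max_dom l : l = j \/ l = k -> ismax l y -> (y \notin s) && dominant (y |: s).
  move=> hl /andP[yM /forall_inP ymax]; rewrite (Mnots l) //=.
  move/M_P: (yM) => yM'.
  apply/dominantP => z; have [zM|] := boolP (z \in M l).
    exists l => x; rewrite !inE => /orP[/eqP->|xs]; first exact: ymax.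
    (* In some order [y] is at most all of [s]; that order can only be [l], as [y] exceeds the
       minima in the others. *)
    apply: leq_trans (ymax _ zM) _; have [i hi] := ds y.
    have [il|il] := eqVneq i l; first by rewrite -il; exact: hi.
    by have := yM' _ il; rewrite ltnNge hi.
  rewrite inE => /forallPn[i]; rewrite negb_imply => /andP[il].
  rewrite -leqNgt => zi; exists i => x; rewrite !inE => /orP[/eqP->|xs].
    exact: leq_trans zi (ltnW (yM' _ il)).
  exact: leq_trans zi (mmin _ _ xs).
apply/idP/orP => [/andP[ys dy]|[]]; last 2 first.
- by apply: max_dom; left.
- by apply: max_dom; right.
(* Each point of [s] has to remain the minimum of [y |: s] in some order. For a point other than
   [m j] this order is determined; for [m j = m k] it is [j] or [k], which puts [y] in [M k] or in
   [M j]. *)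
have above x : x \in s -> exists2 i, m i = x & rk i (m i) < rk i y.
  move=> xs; have /dominantP /(_ x)[i hi] := dy.
  have mix : m i = x by apply: mE => // z zs; apply: hi; rewrite !inE zs orbT.
  exists i => //; rewrite mix ltn_neqAle hi ?setU11 // andbT.
  by apply/eqP => /rk_inj xy; move: ys; rewrite -xy xs.
have out i : i != j -> i != k -> rk i (m i) < rk i y.
  by move=> ij ik; have [i' mi' ] := above _ (ms i); rewrite (inj_out i i').
have yMmax l : y \in M l -> ismax l y.
  move=> yM; rewrite /ismax yM; apply/forall_inP => z /M_P zM.
  have /dominantP /(_ z)[i hi] := dy.
  have [<-|il] := eqVneq i l; first by apply: hi; rewrite setU11.
  by have := zM _ il; rewrite ltnNge hi // !inE ms orbT.
have [i mi yi] := above _ (ms j).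
case: (same i mi) => ii; [right|left]; apply: yMmax; apply/M_P => i' i'i.
- by have [->|] := eqVneq i' j; [rewrite -ii | move=> ?; exact: out].
- by have [->|] := eqVneq i' k; [rewrite -ii | move=> ?; exact: out].
Qed.

End Dominant.

(** * Rooms, doors and the parity count *)

Section Scarf.
Variables (I X : finType) (rX : I -> X -> nat) (c : X -> I).
Hypothesis rX_inj : forall i, injective (rX i).

Let bound := \max_(i : I) \max_(x : X) rX i x.

(* Scarf's slack element [inl j] is the least one in the order [j] and lies
   above every [inr x] in the other orders. *)
Let rk (i : I) (y : I + X) : nat :=
  match y with
  | inl j => if j == i then 0 else bound.+2 + enum_rank j
  | inr x => (rX i x).+1
  end.

Let label (y : I + X) : I := match y with inl j => j | inr x => c x end.

Let rX_bound i x : rX i x <= bound.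
Proof. by rewrite /bound (bigmaxD1 i) // leq_max (bigmaxD1 x) // leq_max leqnn. Qed.

Let rk_inj i : injective (rk i).
Proof.
move=> [j|x] [j'|x'] //=.
- case: eqVneq => [->|_]; case: eqVneq => [->|_] //; try by lia.
  by move/addnI/ord_inj/enum_rank_inj->.
- by have := rX_bound i x'; case: eqVneq => //; lia.
- by have := rX_bound i x; case: eqVneq => //; lia.
- by case=> /rX_inj->.
Qed.

Let room (t : {set I + X}) := dominant rk t && (#|t| == #|I|).
(** The cardinality forces the labels of a door to be distinct. *)
Let door i0 (s : {set I + X}) :=
  [&& dominant rk s, #|s|.+1 == #|I| & label @: s == [set~ i0]].

(** A fully labelled room has one door, left by removing its element of label [i0]. A room lacking
    only the label [i0] repeats exactly one label and has two doors, left by removing either of the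
    two elements. Any other room has none. *)
Lemma odd_doors_of_room i0 (t : {set I + X}) : room t ->
  odd #|[set y in t | door i0 (t :\ y)]| = (label @: t == setT).
Proof.
case/andP=> dt /eqP ct.
have doorE y : y \in t -> door i0 (t :\ y) = (label @: (t :\ y) == [set~ i0]).
  move=> yt; rewrite /door (dominantS (subD1set t y) dt) /=.
  by rewrite -ct (cardsD1 y t) yt eqxx.
have label_rm y : y \in t -> label @: t = label y |: label @: (t :\ y).
  by move=> yt; rewrite -imsetU1 setD1K.
have [full|nfull] := eqVneq (label @: t) setT.
  have linj : {in t &, injective label}.
    by apply/imset_injP; rewrite full ct cardsT.
  have : i0 \in label @: t by rewrite full.
  case/imsetP => y yt i0y.
  suff -> : [set z in t | door i0 (t :\ z)] = [set y] by rewrite cards1.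
  have rmE z : z \in t -> label @: (t :\ z) = [set~ label z].
    move=> zt; apply/setP => i; rewrite !inE.
    have : i \in label @: t by rewrite full.
    case/imsetP=> v vt ->; apply/imsetP/idP => [[v']|lvz].
      rewrite !inE => /andP[v'z v't] ->; apply: contra_neq v'z; exact: linj.
    by exists v => //; rewrite !inE vt andbT; apply: contra_neq lvz => ->.
  apply/setP => z; rewrite !inE; apply/andP/eqP => [[zt]|->].
    rewrite doorE // rmE // => /eqP/setP/(_ (label z)); rewrite !inE eqxx.
    by move/esym/negbFE/eqP; rewrite i0y; exact: linj.
  by rewrite doorE // rmE // i0y.
have [->|[y]] := set_0Vmem [set y in t | door i0 (t :\ y)]; first by rewrite cards0.
rewrite inE => /andP[yt]; rewrite doorE // => /eqP ly.
have lt : label @: t = [set~ i0].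
  have := label_rm y yt; rewrite ly => ltE; apply/eqP.
  move: nfull; rewrite ltE; have [->|lyi0] := eqVneq (label y) i0.
    by rewrite setUCr eqxx.
  by move=> _; apply/eqP/setP => i; rewrite !inE; case: eqVneq => // ->.
have [|a [b [[aD bD ab lab] inja injb]]] := @almost_inj_on _ _ label t.
  by rewrite lt ct cardsC1 prednK //; apply/card_gt0P; exists i0.
have ba : b != a by rewrite eq_sym.
suff -> : [set z in t | door i0 (t :\ z)] = [set a; b] by rewrite cards2 ab.
have rm_ok u v : u \in t -> v \in t -> v != u -> label u = label v ->
    label @: (t :\ u) = [set~ i0].
  move=> ut vt vu luv; rewrite -lt (label_rm u) // luv; apply/eqP.
  rewrite eqEsubset subsetUr subUset subxx andbT /= sub1set.
  by apply: imset_f; rewrite !inE vu.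
apply/setP => z; rewrite !inE; apply/andP/orP => [[zt]|[]/eqP->]; last 2 first.
- by rewrite doorE //; split => //; apply/eqP/(rm_ok _ b).
- by rewrite doorE //; split => //; apply/eqP/(rm_ok _ a).
rewrite doorE // -lt => /eqP lz.
have : label z \in label @: (t :\ z) by rewrite lz imset_f.
case/imsetP => v; rewrite !inE => /andP[vz vt] lzv.
have [_|za] := eqVneq z a; first by left.
have [_|zb] := eqVneq z b; first by right.
have [va|va] := eqVneq v a.
  suff zv : z = v by rewrite zv eqxx in vz.
  by apply: injb lzv; rewrite !inE ?zb ?zt ?vt ?va ?ab.
suff zv : z = v by rewrite zv eqxx in vz.
by apply: inja lzv; rewrite !inE ?za ?zt ?vt ?va.
Qed.

Let slack i0 : {set I + X} := inl @: [set~ i0].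

Let extensions (s : {set I + X}) := [set y | (y \notin s) && room (y |: s)].

(** Adding [inl i0] would make every minimum 0, and [inr x0] exceeds them all. When some [inr x] is
    added, the other orders still have minimum 0, so dominance requires [x] to be the greatest in
    the order [i0]. *)
Lemma extensions_slack i0 (x0 : X) : #|extensions (slack i0)| = 1.
Proof.
have memr x : inr x \notin slack i0 by apply/negP => /imsetP[].
have meml j : (inl j \in slack i0) = (j != i0).
  by rewrite mem_imset ?inE // => ? ? [].
case: (@arg_maxnP _ x0 xpredT (rX i0)) => // x _ max_x.
have xmax y : rX i0 y <= rX i0 x by exact: max_x.
apply/eqP/cards1P; exists (inr x); apply/setP => -[j|y]; rewrite !inE ?memr ?meml /=.
  rewrite negbK; apply/negP => /andP[/eqP-> /andP[/dominantP/(_ (inr x0))[i hi] _]].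
  have /hi : inl i \in inl i0 |: slack i0.
    by rewrite !inE meml; case: (eqVneq i i0) => [->|]; rewrite ?eqxx ?orbT.
  by rewrite /= eqxx.
apply/idP/eqP => [/andP[/dominantP/(_ (inr x))[i hi] _]|[->]] /=.
  have [ii0|ii0] := eqVneq i i0.
    have := hi (inr y); rewrite !inE eqxx ii0 => /(_ isT) /= le.
    by congr inr; apply: (@rX_inj i0); apply/eqP; rewrite eqn_leq xmax // -ltnS.
  by have := hi (inl i); rewrite !inE meml ii0 => /(_ isT); rewrite /= eqxx.
rewrite /room cardsU1 memr card_imset => [|? ? []//].
rewrite cardsC1 add1n prednK ?eqxx ?andbT; last by apply/card_gt0P; exists i0.
apply/dominantP => -[j|v]; first by exists j => z _ /=; rewrite eqxx.
exists i0 => -[j|z]; rewrite !inE ?meml /=; last first.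
  by rewrite (negPf (memr _)) orbF => /eqP[->]; rewrite ltnS; exact: xmax.
by move=> /negPf->; have := rX_bound i0 v; lia.
Qed.

(** A door other than [slack i0] contains some [inr x], which keeps all its minima under the large
    ranks of the slack elements. So [inl l] lies in [above rk m l] for every [l], and there are two
    extensions. *)
Lemma odd_extensions i0 (x0 : X) (s : {set I + X}) : door i0 s ->
  odd #|extensions s| = (s == slack i0).
Proof.
case/and3P => ds /eqP cs /eqP ls.
have [->|sn] := eqVneq s (slack i0); first by rewrite extensions_slack.
have [x xs] : exists x, inr x \in s.
  have [|none] := boolP [exists x, inr x \in s].
    by case/existsP => x; exists x.
  case/eqP: sn; apply/setP => -[j|x]; last first.
    transitivity false; first by apply: contraNF none => ?; apply/existsP; exists x.
    by apply/esym/negP => /imsetP[].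
  rewrite mem_imset ?inE; last by move=> ? ? [].
  have : (j \in label @: s) = (j != i0) by rewrite ls !inE.
  move=> <-; apply/idP/imsetP => [js|[[j'|x'] zs /= ->]//]; first by exists (inl j).
  by case/existsP: none; exists x'.
pose m i := [arg min_(y < inr x in s) rk i y].
have mP i : m i \in s /\ forall y, y \in s -> rk i (m i) <= rk i y.
  by rewrite /m; case: arg_minnP.
have [||j [k [jk mjk]]] := @dominant_extensions _ _ rk rk_inj s m ds cs.
- by move=> i; case: (mP i).
- by move=> i y; case: (mP i) => _; exact.
have above_neq0 l : above rk m l != set0.
  apply/set0Pn; exists (inl l); rewrite inE; apply/forallP => i; apply/implyP => il.
  rewrite /= eq_sym (negPf il); have [_ /(_ _ xs)] := mP i.
  by have := rX_bound i x; rewrite /=; lia.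
rewrite !above_neq0 => E.
suff -> : extensions s = [set y | (y \notin s) && dominant rk (y |: s)] by rewrite E.
apply/setP => y; rewrite !inE; case: (boolP (y \in s)) => //= ys.
by rewrite /room cardsU1 ys add1n cs eqxx andbT.
Qed.

(* Count modulo 2 the pairs of a room and a door in it: a room has an odd number
   of doors iff its elements carry all labels, and every door lies in two rooms,
   except [slack i0], which lies in one. *)
Lemma scarf (x0 : X) : exists (s : {set X}) (C : {set I}),
  [/\ s != set0, forall i, i \in C -> exists2 x, x \in s & c x = i &
     forall y, exists2 i, i \in C & forall x, x \in s -> rX i y <= rX i x].
Proof.
have [full|] := boolP [exists t, room t && (label @: t == setT)].
  have [t /andP[/andP[dt ct] /eqP lt]] := existsP full.
  exists [set x | inr x \in t], [set i | inl i \notin t].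
  (* An order whose slack element is in [t] has minimum 0, so it cannot be the one that dominates
     [inr y]. *)
  have dom y : exists2 i, inl i \notin t &
      forall x, inr x \in t -> rX i y <= rX i x.
    have /dominantP/(_ (inr y))[i hi] := dt; exists i; last by move=> x /hi.
    by apply/negP => /hi; rewrite /= eqxx.
  have lab i : inl i \notin t -> exists2 x, inr x \in t & c x = i.
    move=> it; have : i \in label @: t by rewrite lt.
    by case/imsetP => -[j|x] /= xt ij; [rewrite ij xt in it|exists x].
  split => [||y].
  - have [i /lab[x xt _] _] := dom x0; apply/set0Pn; exists x; by rewrite inE.
  - by move=> i; rewrite inE => /lab[x xt <-]; exists x; rewrite ?inE.
  - by have [i it hi] := dom y; exists i; rewrite ?inE // => x; rewrite inE; exact: hi.
move=> nofull; exfalso.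
have i0 := c x0.
have : \sum_(t | room t) #|[set y in t | door i0 (t :\ y)]|
     = \sum_(s | door i0 s) #|extensions s|.
  under eq_bigr do rewrite -sum1dep_card.
  under [RHS]eq_bigr do rewrite -sum1dep_card.
  rewrite (exchange_big_dep xpredT) //= [RHS](exchange_big_dep xpredT) //=.
  apply: eq_bigr => y _.
  (* For a fixed removed element [y], rooms [t] containing [y] correspond to sets [s = t :\ y]
     avoiding it. *)
  rewrite (reindex_onto (fun s => y |: s) (fun t => t :\ y)) /=; last first.
    by move=> t /andP[_ /andP[yt _]]; rewrite setD1K.
  apply: eq_bigl => s; rewrite setU11 /=.
  have [ys|ys] := boolP (y \in s).
    rewrite andbF; apply/negP => /andP[_ /eqP] /setP /(_ y).
    by rewrite !inE eqxx ys.
  by rewrite setU1K // eqxx andbT andbC.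
move/(congr1 odd).
have odd_sum (T : finType) (P : pred T) F :
    odd (\sum_(t | P t) F t) = \big[addb/false]_(t | P t) odd (F t).
  by apply: (big_morph odd) => // ? ?; rewrite oddD.
(* With no fully labelled room the left side is even, whereas [slack i0] alone makes the right side
   odd. *)
rewrite !odd_sum big1 => [|t rt]; last first.
  rewrite odd_doors_of_room //; apply: contraNF nofull => lt.
  by apply/existsP; exists t; rewrite rt.
rewrite (eq_bigr _ (odd_extensions x0)) (bigD1 (slack i0)) /=.
  by rewrite eqxx big1 // => s /andP[_ /negPf].
rewrite /door card_imset ?cardsC1 ?prednK; last 2 first.
- by apply/card_gt0P; exists i0.
- by move=> ? ? [].
rewrite eqxx /= -imset_comp imset_id eqxx andbT.
apply/dominantP => -[j|y]; first by exists j => z _ /=; rewrite eqxx.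
exists i0 => z /imsetP[j]; rewrite !inE => ji0 -> /=; rewrite (negPf ji0).
by have := rX_bound i0 y; lia.
Qed.

End Scarf.

(** A substitute for Sperner's lemma: [s] plays the part of a small fully labelled cell, where a
    label may be missing only if the cell is near the opposite facet. It is Scarf's lemma for the
    orders given by the coordinates. *)
Lemma grid_sperner (n N : nat) (c : {ffun 'I_n -> 'I_N.+1} -> 'I_n) : 0 < n ->
  exists (s : {set {ffun 'I_n -> 'I_N.+1}}) (m : 'I_n -> nat),
  [/\ exists x, x \in s, forall x, x \in s -> \sum_i x i = N,
      forall x i, x \in s -> m i <= x i <= m i + n &
      forall i, m i = 0 \/ exists2 x, x \in s & c x = i].
Proof.
case: n c => // n c _.
pose X : finType := {x : {ffun 'I_n.+1 -> 'I_N.+1} | \sum_i x i == N}.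
have mkX (k : 'I_n.+1 -> nat) : \sum_i k i = N ->
    exists x : X, forall i, val x i = k i :> nat.
  move=> kN; have kle i : k i < N.+1 by rewrite ltnS -kN (bigD1 i) //= leq_addr.
  pose x : {ffun 'I_n.+1 -> 'I_N.+1} := [ffun i => Ordinal (kle i)].
  have xP : \sum_i x i == N.
    by rewrite -[X in _ == X]kN; apply/eqP/eq_bigr => i _; rewrite ffunE.
  by exists (Sub x xP) => i; rewrite SubK ffunE.
have [x0 _] : exists x : X, forall i, val x i = (if i == ord0 then N else 0) :> nat.
  by apply: mkX; rewrite -big_mkcond big_pred1_eq.
(* The order of the [i]-th coordinate, with ties broken by the enumeration to make it injective. *)
pose rX i (x : X) := val x i * #|X| + enum_rank x.
have rX_inj i : injective (rX i).
  move=> x y /(congr1 (modn^~ #|X|)); rewrite /rX !modnMDl !modn_small //.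
  by move/ord_inj/enum_rank_inj.
have rX_le i x y : rX i x <= rX i y -> val x i <= val y i.
  rewrite /rX => le; rewrite -ltnS -(@ltn_pmul2r #|X|); last by apply/card_gt0P; exists x.
  apply: leq_ltn_trans (leq_addr _ _) (leq_ltn_trans le _).
  by rewrite mulSn addnC ltn_add2r.
have [s [C [/set0Pn[x1 x1s] labC dom]]] := scarf (c \o val) rX_inj x0.
have ex_min i : exists k, [exists x in s, val x i == k :> nat].
  by exists (val x1 i); apply/exists_inP; exists x1.
pose mn i := ex_minn (ex_min i).
have mnP i : (exists2 x, x \in s & val x i = mn i :> nat) /\
             forall x, x \in s -> mn i <= val x i.
  rewrite /mn; case: ex_minnP => k /exists_inP[x xs /eqP xk] kmin.
  split; first by exists x.
  by move=> y ys; apply: kmin; apply/exists_inP; exists y.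
(* Outside [C] no label is guaranteed, so the bound is set to 0, the other alternative of the
   conclusion. *)
exists (val @: s), (fun i => if i \in C then mn i else 0); split.
- by exists (val x1); apply: imset_f.
- by move=> _ /imsetP[x _ ->]; apply/eqP; exact: (valP x).
- have sum_gt : N < \sum_(i in C) (mn i).+1.
    rewrite ltnNge; apply/negP => le.
    have [i1 i1C _] := dom x0.
    (* A grid point exceeding the minimum in every order of [C], against dominance; the leftover
       mass is put on [i1] so that the sum is [N]. *)
    pose k i := (if i \in C then (mn i).+1 else 0)
              + (if i == i1 then N - \sum_(i in C) (mn i).+1 else 0).
    have [y yk] : exists y : X, forall i, val y i = k i :> nat.
      apply: mkX; rewrite big_split /= -big_mkcond /=.
      by rewrite -[X in _ + X]big_mkcond big_pred1_eq subnKC.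
    have [i iC hi] := dom y; have [[x xs xi] _] := mnP i.
    by have := rX_le _ _ _ (hi _ xs); rewrite yk /k iC xi; lia.
  move=> _ i /imsetP[x xs ->]; pose m j := if j \in C then mn j else 0.
  have mle j : m j <= val x j by rewrite /m; case: ifP => // _; case: (mnP j) => _; exact.
  rewrite -/(m i) mle /=.
  (* The excess of [x] over [m] is nonnegative in each coordinate, so a bound on the total excess
     bounds each one. *)
  have : \sum_j val x j <= \sum_j m j + n.+1.
    rewrite (eqP (valP x)); apply: leq_trans (ltnW sum_gt) _.
    rewrite -big_mkcond /=; under eq_bigr do rewrite -addn1.
    rewrite big_split /= leq_add2l sum1_card.
    by have := max_card (mem C); rewrite card_ord.
  rewrite (bigD1 i) //= [X in _ <= X + _](bigD1 i) //= -addnA addnCA => le.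
  rewrite -(leq_add2r (\sum_(j | j != i) sval x j)); apply: leq_trans le _.
  by rewrite addnC leq_add2l; apply: leq_sum => j _; exact: mle.
- move=> i; case: ifP => iC; last by left.
  by have [x xs cx] := labC i iC; right; exists (val x); rewrite ?imset_f.
Qed.

End Combinatorics.

(** * Compactness and the KKM lemma *)

Section Analysis.
Set Implicit Arguments. Unset Strict Implicit.
Local Open Scope classical_set_scope.
Local Open Scope ring_scope.

(** Replaces the extraction of a subsequence as [d] tends to 0: the limit is a cluster point of
    solutions for [d = 1/(n+1)], and monotonicity carries these to larger [d]. *)
Lemma compact_limit_point (R : realType) (V : normedModType R) (A : set V)
    (P : R -> V -> Prop) :
  compact A -> (forall d e x, d <= e -> P d x -> P e x) ->
  (forall d, 0 < d -> exists2 x, A x & P d x) ->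
  exists2 x, A x & forall d, 0 < d -> exists2 y, `|y - x| < d & P d y.
Proof.
move=> cA Pmono exP.
have /choice[u uP] : forall n : nat, exists x, A x /\ P n.+1%:R^-1 x.
  by move=> n; have [|x Ax Px] := exP n.+1%:R^-1; [rewrite invr_gt0|exists x].
have [|x [Ax clx]] := cA (u @ \oo) _.
  by exists 0%N => // n _; have [] := uP n.
exists x => // d d0.
have [N _ Nd] : \forall n \near \oo, n.+1%:R^-1 < d :> R.
  exact: near_infty_natSinv_lt (PosNum d0).
have [_ [[n Nn <-] ]] := clx (u @` [set n | (N <= n)%N]) (ball x d)
  (ex_intro2 _ _ N I (fun n Nn => ex_intro2 _ _ n Nn erefl)) (nbhsx_ballx x d d0).
rewrite -ball_normE /= => xn; exists (u n); first by rewrite distrC.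
by have [_] := uP n; apply: Pmono; apply/ltW/Nd.
Qed.

Definition std_simplex (R : realType) n : set 'rV[R]_n :=
  [set l | (forall i, 0 <= l ord0 i) /\ \sum_i l ord0 i = 1].

Lemma std_simplex_le1 (R : realType) n (l : 'rV[R]_n) i :
  std_simplex l -> l ord0 i <= 1.
Proof.
move=> [l0 <-]; rewrite (bigD1 i) //= lerDl.
by apply: sumr_ge0 => j _; exact: l0.
Qed.

Lemma compact_std_simplex (R : realType) n : compact (@std_simplex R n).
Proof.
apply: bounded_closed_compact.
  exists 1; split => // M M1 l Sl; apply: (le_trans _ (ltW M1)).
  rewrite [leLHS]/Num.norm /= mx_normrE; apply/bigmax_leP; split => // -[i j] _ /=.
  by rewrite (ord1 i) ger0_norm ?std_simplex_le1 //; case: Sl.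
have -> : @std_simplex R n =
    (\bigcap_i [set l | 0 <= l ord0 i]) `&` [set l | \sum_i l ord0 i = 1].
  apply/seteqP; split => l [l0 l1]; split => // i; last exact: l0.
  by move=> _; exact: l0.
apply: closedI.
  apply: closed_bigI => i _.
  have /continuous_closedP := @coord_continuous R 1 n ord0 i.
  by move=> /(_ _ (@closed_ge R 0)).
suff /continuous_closedP : continuous (fun l : 'rV[R]_n => \sum_i l ord0 i).
  by move=> /(_ _ (@closed_eq R 1)).
apply: continuous_big => [|i _]; [exact: add_continuous|exact: coord_continuous].
Qed.

(* The Knaster-Kuratowski-Mazurkiewicz lemma: the closed sets [0 <= f i], each
   enlarged by the facet opposite to the vertex [i], have a common point. *)
Lemma kkm (R : realType) n (f : 'I_n -> 'rV[R]_n -> R) :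
  (0 < n)%N -> (forall i, continuous (f i)) ->
  (forall l, std_simplex l -> exists i, 0 <= f i l) ->
  exists2 l, std_simplex l & forall i, 0 <= f i l \/ l ord0 i = 0.
Proof.
move=> n0 cf exf.
have [|d e l de Pd|d d0|l Sl lP] := @compact_limit_point R _ (@std_simplex R n)
    (fun d l => forall i, exists2 mu, `|mu - l| < d & 0 <= f i mu \/ mu ord0 i < d).
- exact: compact_std_simplex.
- move=> i; have [mu mul H] := Pd i; exists mu; first exact: lt_le_trans de.
  by case: H => [?|H]; [left|right; exact: lt_le_trans de].
- have e0 : 0 < n%:R^-1 * d by rewrite mulr_gt0 // invr_gt0 ltr0n.
  (* On the grid of step [1/N1], two points of the set given by [grid_sperner] differ by at most
     [n/N1] in each coordinate, which is to be less than [d]. *)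
  have [N _ /(_ N (leqnn N))] := near_infty_natSinv_lt (PosNum e0).
  rewrite /= ltr_pdivlMl ?ltr0n //; set N1 := N.+1 => Nd.
  have N10 : 0 < N1%:R :> R by rewrite ltr0n.
  pose pt (x : {ffun 'I_n -> 'I_N1.+1}) : 'rV[R]_n := \row_i ((x i)%:R / N1%:R).
  have Spt (x : {ffun 'I_n -> 'I_N1.+1}) : (\sum_i x i = N1)%N -> std_simplex (pt x).
    move=> xN; split=> [i|]; first by rewrite mxE divr_ge0.
    under eq_bigr do rewrite mxE.
    by rewrite -mulr_suml -natr_sum xN divff // gt_eqF.
  (* A point of the simplex is labelled by an index at which [f] is nonnegative; elsewhere the label
     is arbitrary. *)
  have /choice[c cP] : forall x : {ffun 'I_n -> 'I_N1.+1}, exists i,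
      (\sum_i x i = N1)%N -> 0 <= f i (pt x).
    move=> x; have [/Spt/exf[i fi]|xN] := pselect (\sum_i x i = N1)%N.
      by exists i.
    by exists (Ordinal n0).
  have [s [m [[x xs] sN sm mc]]] := grid_sperner c n0.
  exists (pt x); first by apply/Spt/sN.
  move=> i; have [m0|[y ys cy]] := mc i.
    exists (pt x); first by rewrite subrr normr0.
    right; rewrite mxE; apply: le_lt_trans Nd.
    rewrite ler_pM2r ?invr_gt0 // ler_nat.
    by have := sm _ i xs; rewrite m0 => /andP[].
  exists (pt y); last by left; rewrite -cy; apply/cP/sN.
  rewrite /Num.norm /= mx_normrE; apply/bigmax_ltP; split => // -[k j] _ /=.
  rewrite !mxE -mulrBl normrM (gtr0_norm (_ : 0 < N1%:R^-1)) ?invr_gt0 //.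
  apply: le_lt_trans Nd; rewrite ler_pM2r ?invr_gt0 //.
  have /andP[mx xm] := sm _ j xs; have /andP[my ym] := sm _ j ys.
  have xyn : ((x j : nat) <= y j + n)%N by lia.
  have yxn : ((y j : nat) <= x j + n)%N by lia.
  move: xyn yxn; rewrite -!(ler_nat R) !natrD ler_norml; lra.
exists l => // i; have [fi|fi] := lerP 0 (f i l); first by left.
right; apply/eqP; rewrite eq_le; case: (Sl) => -> _; rewrite andbT leNgt.
apply/negP => li.
have fN : \forall mu \near l, f i mu < 0 by exact: (cf i l _ (lt_nbhsl fi)).
have lN : \forall mu \near l, l ord0 i / 2 < (mu : 'rV[R]_n) ord0 i.
  have lt_half : l ord0 i / 2 < l ord0 i by lra.
  exact: (@coord_continuous R 1 n ord0 i l _ (lt_nbhsr lt_half)).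
have /nbhs_ballP[e /= e0 be] :
    nbhs l [set mu : 'rV[R]_n | f i mu < 0 /\ l ord0 i / 2 < mu ord0 i].
  exact: filterI fN lN.
(* The first bound keeps [mu], two steps of length [d] away from [l], in the ball of radius [e]; the
   second makes [mu ord0 i < d] contradict [l ord0 i / 2 < mu ord0 i]. *)
pose d := Num.min (e / 2) (l ord0 i / 2).
have d0 : 0 < d by rewrite lt_min; apply/andP; split; lra.
have [de dl] : d <= e / 2 /\ d <= l ord0 i / 2 by rewrite !ge_min !lexx orbT.
have [y yl /(_ i)[mu muy H]] := lP d d0.
have : ball l e mu.
  rewrite -ball_normE /= distrC; apply: le_lt_trans (ler_distD y _ _) _; lra.
by move=> /be[]; case: H; lra.
Qed.

Lemma compact_finite_net (R : realType) (V : normedModType R) (A : set V) (e : R) :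
  compact A -> 0 < e ->
  exists n (q : 'I_n -> V), (forall i, A (q i)) /\
    forall x, A x -> exists i, `|x - q i| < e.
Proof.
rewrite compact_cover => cA e0.
have [|x Ax|D DA AD] := cA V A (fun q => ball q e).
- by move=> q _; exact: ball_open.
- by exists x => //; exact: ballxx.
pose s : seq V := finmap.enum_fset D.
exists (size s), (fun i => tnth (in_tuple s) i); split.
  by move=> i; apply/set_mem/DA; exact: mem_tnth.
move=> x /AD[q qD]; rewrite -ball_normE /= distrC => xq.
have /tnthP[i qi] : q \in in_tuple s by [].
by exists i; rewrite -qi.
Qed.

(** An ultrafilter on [A] contains one of finitely many balls of each given radius, so it is Cauchy
    and converges by completeness. *)
Lemma totally_bounded_compact (R : realType) (V : completeNormedModType R)
    (A : set V) :
  closed A ->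
  (forall e : R, 0 < e -> exists n (q : 'I_n -> V),
     forall x, A x -> exists i, `|x - q i| < e) ->
  compact A.
Proof.
move=> clA tbA; rewrite compact_ultra => F UF FA.
have PF : ProperFilter F by exact: ultra_proper.
have cvgF : cvg F.
  apply: cauchy_cvg; apply: cauchy_exP => e e0.
  have [n [q qA]] := tbA e e0.
  have [[i Fi]|noF] := pselect (exists i, F (ball (q i) e)); first by exists (q i).
  have FN i : F (~` ball (q i) e).
    by have [Fi|//] := in_ultra_setVsetC (ball (q i) e) UF; case: noF; exists i.
  have [x [Ax Nx]] := filter_ex (filterI FA (filter_forall PF FN)).
  have [i xi] := qA x Ax; case: (Nx i).
  by rewrite -ball_normE /= distrC.
exists (lim F); split; last exact: cvgF.
exact: (closed_cvg (u_ := id) A clA FA _ cvgF).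
Qed.

(** * Closed convex hulls and fixed points of envelopes *)

Section ConvexHull.
Variables (R : realType) (X : completeNormedModType R).
Implicit Types (A B C : set X) (x y z : X).

(** Dividing by the total weight lets the induction split off one term. Membership is asked where
    the weight is nonzero, since later only such points are known to be close. *)
Lemma convex_comb A n (l : 'I_n -> R) (p : 'I_n -> X) : is_convex A ->
  (forall i, 0 <= l i) -> (forall i, l i != 0 -> A (p i)) ->
  0 < \sum_i l i -> A ((\sum_i l i)^-1 *: \sum_i l i *: p i).
Proof.
move=> cvxA; elim: n l p => [|n IH] l p l0 lp; first by rewrite big_ord0 ltxx.
rewrite !big_ord_recl; set s := \sum_i l _; set z := \sum_i _ *: _.
have s_ge0 : 0 <= s by apply: sumr_ge0 => i _; exact: l0.
have IHs : 0 < s -> A (s^-1 *: z) by apply: IH => i; [exact: l0|exact: lp].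
have [l00|l00] := eqVneq (l ord0) 0; first by rewrite l00 scale0r !add0r.
have lgt : 0 < l ord0 by rewrite lt_def l00 l0.
have [s0|s0] := eqVneq s 0.
  have -> : z = 0.
    apply: big1 => i _; have : s == 0 by apply/eqP.
    rewrite /s psumr_eq0 => [/allP/(_ i)|j _]; last exact: l0.
    by rewrite mem_index_enum => /(_ isT)/eqP ->; rewrite scale0r.
  by rewrite s0 !addr0 scalerA mulVf // scale1r => _; exact: lp.
have s_gt : 0 < s by rewrite lt_def s0.
move=> tot; set t := l ord0 / (l ord0 + s).
have -> : (l ord0 + s)^-1 *: (l ord0 *: p ord0 + z)
        = t *: p ord0 + (1 - t) *: (s^-1 *: z).
  rewrite scalerDr !scalerA; congr (_ *: _ + _ *: _); rewrite /t; field.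
    by rewrite gt_eqF.
  by rewrite !gt_eqF.
apply: cvxA; [exact: lp|exact: IHs| |].
  by rewrite divr_ge0 // ltW.
by rewrite ler_pdivrMr // mul1r lerDl.
Qed.

Lemma std_simplex_comb A n (l : 'rV[R]_n) (p : 'I_n -> X) : is_convex A ->
  std_simplex l -> (forall i, l ord0 i != 0 -> A (p i)) ->
  A (\sum_i l ord0 i *: p i).
Proof.
move=> cvxA [l0 l1] lp; rewrite -[\sum_i _ *: _]scale1r -invr1 -l1.
by apply: convex_comb => //; rewrite l1.
Qed.

Lemma sub_clco A : A `<=` clco A.
Proof. by move=> x Ax C _ _; exact. Qed.

Lemma clco_min A C : closed C -> is_convex C -> A `<=` C -> clco A `<=` C.
Proof. by move=> ? ? ? x; exact. Qed.

Lemma closed_clco A : closed (clco A).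
Proof.
move=> x clx C clC cvxC AC; apply: (clC) => B xB.
by have [y [yA yB]] := clx B xB; exists y; split => //; exact: yA.
Qed.

Lemma convex_clco A : is_convex (clco A).
Proof.
move=> x y t Ax Ay t0 t1 C clC cvxC AC.
by apply: (cvxC) => //; [exact: Ax|exact: Ay].
Qed.

Lemma clcoS A B : A `<=` B -> clco A `<=` clco B.
Proof.
move=> AB; apply: clco_min; [exact: closed_clco|exact: convex_clco|].
exact: subset_trans AB (@sub_clco B).
Qed.

(** The points at distance at most [d] from [A]; quantifying over [e > d] yields a closed set
    without an infimum. *)
Definition thicken A (d : R) : set X :=
  [set z | forall e, d < e -> exists2 a, A a & `|z - a| < e].

Lemma closed_thicken A d : closed (thicken A d).
Proof.
move=> z clz e de.
have e20 : 0 < (e - d) / 2 by rewrite divr_gt0 // subr_gt0.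
have [y [yA]] := clz _ (nbhsx_ballx z _ e20); rewrite -ball_normE /= => zy.
have [|a Aa ya] := yA (d + (e - d) / 2); first by rewrite ltrDl.
exists a => //; apply: le_lt_trans (ler_distD y _ _) _; lra.
Qed.

Lemma convex_thicken A d : is_convex A -> is_convex (thicken A d).
Proof.
move=> cvxA x y t xA yA t0 t1 e de.
have [a Aa xa] := xA e de; have [b Ab yb] := yA e de.
exists (t *: a + (1 - t) *: b); first exact: cvxA.
have -> : t *: x + (1 - t) *: y - (t *: a + (1 - t) *: b)
        = t *: (x - a) + (1 - t) *: (y - b).
  by rewrite !scalerBr opprD addrACA.
have t1' : 0 <= 1 - t by rewrite subr_ge0.
apply: le_lt_trans (ler_normD _ _) _; rewrite !normrZ !ger0_norm //.
have [->|tn0] := eqVneq t 0; first by rewrite mul0r add0r subr0 mul1r.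
have tgt : 0 < t by rewrite lt_def tn0.
have -> : e = t * e + (1 - t) * e by ring.
by apply: ltr_leD; [rewrite ltr_pM2l|apply: ler_wpM2l => //; exact: ltW].
Qed.

Lemma thicken_closed A z : closed A -> (forall d, 0 < d -> thicken A d z) -> A z.
Proof.
move=> clA zA; apply: clA => B /nbhs_ballP[e /= e0 eB].
have [||a Aa za] := zA (e / 2) _ e; [lra|lra|].
by exists a; split => //; apply: eB; rewrite -ball_normE.
Qed.

Lemma convex_comb_image n (q : 'I_n -> X) :
  is_convex [set \sum_i l ord0 i *: q i | l in @std_simplex R n].
Proof.
move=> _ _ t [l [l0 l1] <-] [k [k0 k1] <-] t0 t1.
exists (t *: l + (1 - t) *: k).
  split=> [i|]; first by rewrite !mxE addr_ge0 // mulr_ge0 // subr_ge0.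
  under eq_bigr do rewrite !mxE.
  by rewrite big_split /= -!mulr_sumr l1 k1; ring.
rewrite !scaler_sumr -big_split /=; apply: eq_bigr => i _.
by rewrite !mxE !scalerA -scalerDl.
Qed.

Lemma continuous_comb n (q : 'I_n -> X) :
  continuous (fun l : 'rV[R]_n => \sum_i l ord0 i *: q i).
Proof.
apply: continuous_big => [|i _ l]; first exact: add_continuous.
exact: (cvgZr_tmp (@coord_continuous R 1 n ord0 i l)).
Qed.

(** Mazur's theorem. The hull of a finite net of [C] is a compact image of a simplex; its thickening
    is closed and convex and contains [C], hence [clco C], so a finite net of this polytope is also
    one for [clco C]. *)
Lemma compact_clco C : compact C -> compact (clco C).
Proof.
move=> cC; apply: totally_bounded_compact => [|e e0]; first exact: closed_clco.
have e30 : 0 < e / 3 by rewrite divr_gt0.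
have [n [q [qC Cq]]] := compact_finite_net cC e30.
pose P := [set \sum_i l ord0 i *: q i | l in @std_simplex R n].
have cP : compact P.
  apply: continuous_compact; last exact: compact_std_simplex.
  by apply: continuous_subspaceT; exact: continuous_comb.
have [m [p [_ Pp]]] := compact_finite_net cP e30.
exists m, p => x Cx.
have [y /Pp[i yi] xy] : exists2 y, P y & `|x - y| < e / 2; last first.
  by exists i; apply: le_lt_trans (ler_distD y _ _) _; lra.
suff : clco C `<=` thicken P (e / 3) by move=> /(_ _ Cx); apply; lra.
apply: clco_min; [exact: closed_thicken| |].
  by apply: convex_thicken; exact: convex_comb_image.
move=> {Cx}x /Cq[i xi] d ed; exists (q i); last exact: lt_trans ed.
exists (\row_j (j == i)%:R).
  split=> [j|]; first by rewrite mxE ler0n.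
  rewrite (bigD1 i) //= mxE eqxx big1 ?addr0 // => j /negPf ji.
  by rewrite mxE ji.
rewrite (bigD1 i) //= mxE eqxx scale1r big1 ?addr0 // => j /negPf ji.
by rewrite mxE ji scale0r.
Qed.

(* For an [e]-net [v_i] and the functions [h i], supported in the [e]-balls, the
   KKM lemma yields [x = \sum_i l_i g (v_i)] with [l_i] proportional to [h i x],
   so that only points [v_i] within [e] of [x] contribute. *)
Lemma clco_envelope_fixpoint (C : set X) (g : X -> X) :
  compact C -> C !=set0 -> (forall x, clco C x -> C (g x)) ->
  exists2 x, clco C x &
    forall e, 0 < e -> clco (g @` (cball x e `&` clco C)) x.
Proof.
move=> cC [c Cc] gC; have cK := compact_clco cC; set K := clco C in cK *.
pose P e x := clco (g @` (cball x e `&` K)) x.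
have [|d e x de|e e0|x Kx xP] := @compact_limit_point R X K P.
- exact: cK.
- apply: clcoS => _ [y [yx Ky] <-]; exists y => //; split => //.
  exact: le_trans de.
- have [n [v [vK Kv]]] := compact_finite_net cK e0.
  have n0 : (0 < n)%N.
    by have [i _] := Kv c (sub_clco Cc); apply: leq_ltn_trans (ltn_ord i).
  pose x (l : 'rV[R]_n) := \sum_i l ord0 i *: g (v i).
  pose u i l := e - `|x l - v i|.
  (* Twice the positive part of [u i l]. *)
  pose h i l := u i l + `|u i l|.
  pose f i l := h i l - l ord0 i * \sum_j h j l.
  have h0 i l : 0 <= h i l by rewrite /h; case: (ger0P (u i l)); lra.
  have [||l Sl fl] := @kkm R n f n0.
  + have cx : continuous x by exact: continuous_comb.
    have ch i : continuous (h i).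
      have cu : continuous (u i).
        move=> l; exact: (cvgB (cvg_cst e) (cvg_norm (cvgB (cx l) (cvg_cst (v i))))).
      move=> l; exact: (cvgD (cu l) (cvg_norm (cu l))).
    have cH : continuous (fun l => \sum_j h j l).
      by apply: continuous_big => //; exact: add_continuous.
    move=> i l.
    exact: (cvgB (ch i l) (cvgM (@coord_continuous R 1 n ord0 i l) (cH l))).
  + move=> l [l0 l1]; apply: contrapT => /forallNP fneg.
    have : \sum_i f i l < \sum_(i < n) 0.
      apply: ltr_sum => [|i _].
        by apply/hasP; exists (Ordinal n0); rewrite ?mem_index_enum.
      by rewrite ltNge; apply/negP.
    by rewrite sumrB -mulr_suml l1 mul1r subrr big1_eq ltxx.
  (* Where [l ord0 i] vanishes, [f i l] is [h i l], so all [f i l] are nonnegative; their sum is 0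
     on the simplex. *)
  have f0 i : f i l = 0.
    have fge j : 0 <= f j l.
      by case: (fl j) => // lj; rewrite /f lj mul0r subr0.
    have /eqP : \sum_j f j l = 0.
      by rewrite sumrB -mulr_suml; case: Sl => _ ->; rewrite mul1r subrr.
    by rewrite psumr_eq0 // => /allP/(_ i); rewrite mem_index_enum => /(_ isT)/eqP.
  have Kx : K (x l).
    apply: std_simplex_comb => // [|i _]; first exact: convex_clco.
    by apply: sub_clco; apply: gC; exact: vK.
  exists (x l) => //.
  rewrite /P; apply: std_simplex_comb => // [|i li]; first exact: convex_clco.
  apply: sub_clco; exists (v i) => //; split => //=.
  have [j xj] := Kv _ Kx.
  have H0 : 0 < \sum_j h j l.
    rewrite (bigD1 j) //= ltr_wpDr ?sumr_ge0 //.
    have : 0 < u j l by rewrite subr_gt0.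
    by rewrite /h; case: (ger0P (u j l)); lra.
  have : 0 < h i l.
    move/eqP: (f0 i); rewrite subr_eq0 => /eqP ->.
    by apply: mulr_gt0 => //; rewrite lt_def li; case: Sl => + _; exact.
  by rewrite /cball /= distrC /h; case: (ger0P (u i l)); rewrite /u; lra.
exists x => // e e0.
apply: closed_clco => B /nbhs_ballP[d /= d0 dB].
(* The ball of radius [d'] about [y], itself within [d'] of [x], then lies in the ball of radius [e]
   about [x]. *)
pose d' := Num.min d (e / 2).
have d'0 : 0 < d' by rewrite lt_min d0 divr_gt0.
have [d'd d'e] : d' <= d /\ d' <= e / 2 by rewrite !ge_min !lexx orbT.
have [y yx Py] := xP d' d'0; exists y; split; last first.
  by apply: dB; rewrite -ball_normE /= distrC; exact: lt_le_trans d'd.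
apply: clcoS Py => _ [z [zy Kz] <-]; exists z => //; split => //=.
apply: le_trans (ler_distD y _ _) _; move: zy; rewrite /cball /=; lra.
Qed.

End ConvexHull.

(** The identity clamped to the interval between the radii, reflected by [a + b - s] when [a < b],
    as the profile must then decrease. *)
Lemma radius_profile (R : realType) (a b : R) : a != b ->
  exists p : R -> R, [/\ continuous p,
    forall s, s <= Num.min a b -> p s = b, forall s, Num.max a b <= s -> p s = a,
    forall s, Num.min a b < s -> s < Num.max a b ->
      Num.min a b < p s < Num.max a b &
    forall s, Num.min a b <= p s <= Num.max a b].
Proof.
pose clamp (c d s : R) := Num.max c (Num.min s d).
have cont_clamp c d : continuous (clamp c d).
  move=> s; apply: (@continuous_max R _ (cst c) (fun s => Num.min s d)).
    exact: cvg_cst.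
  apply: (@continuous_min R _ id (cst d)); [exact: cvg_id|exact: cvg_cst].
have clampE c d s : c < d ->
    [/\ s <= c -> clamp c d s = c, d <= s -> clamp c d s = d,
        c < s -> s < d -> clamp c d s = s & c <= clamp c d s <= d].
  move=> cd; rewrite /clamp.
  by case: (leP s d) => sd; [case: (leP c s)|case: (leP c d)] => ?;
    split=> *; try (apply/andP; split); lra.
case: (ltgtP a b) => // ab _.
  exists (fun s => a + b - clamp a b s); split.
  - move=> s; exact: (cvgB (cvg_cst (a + b)) (cont_clamp a b s)).
  - by move=> s sa; case: (clampE a b s ab) => -> //; lra.
  - by move=> s sb; case: (clampE a b s ab) => _ -> //; lra.
  - by move=> s sa sb; case: (clampE a b s ab) => _ _ -> //; lra.
  - by move=> s; case: (clampE a b s ab) => _ _ _; lra.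
exists (clamp b a); split.
- exact: cont_clamp.
- by move=> s sa; case: (clampE b a s ab) => ->.
- by move=> s sb; case: (clampE b a s ab) => _ ->.
- by move=> s sa sb; case: (clampE b a s ab) => _ _ -> //; rewrite sa.
- by move=> s; case: (clampE b a s ab).
Qed.

(** A thickening of [S] is closed and convex, so once it contains [g] of a small ball it contains
    the closed hull as well; then the thickness tends to 0. *)
Lemma closed_convex_envelope_sub (R : realType) (X : completeNormedModType R)
    (D S : set X) (g : X -> X) (x : X) :
  closed S -> is_convex S ->
  (forall d, 0 < d -> \forall y \near x, D y -> thicken S d (g y)) ->
  (forall e, 0 < e -> clco (g @` (cball x e `&` D)) x) -> S x.
Proof.
move=> clS cvxS near_S xg; apply: thicken_closed => // d d0.
have /nbhs_ballP[e /= e0 eS] := near_S d d0.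
have e20 : 0 < e / 2 by rewrite divr_gt0.
apply: clco_min (xg _ e20); [exact: closed_thicken|exact: convex_thicken|].
move=> _ [y [yx Dy] <-]; apply: eS => //.
by rewrite -ball_normE /= distrC; move: yx; rewrite /cball /=; lra.
Qed.

Lemma cone_comb (R : realType) (X : completeNormedModType R) (K : set X)
    (a b : R) (x y : X) :
  is_cone K -> 0 <= a -> 0 <= b -> K x -> K y -> K (a *: x + b *: y).
Proof.
move=> [_ cvxK ZK _] a0 b0 Kx Ky.
have -> : a *: x + b *: y
    = 2 *: (2^-1 *: (a *: x) + (1 - 2^-1) *: (b *: y)).
  by rewrite scalerDr !scalerA; congr (_ *: _ + _ *: _); lra.
by apply: (ZK) => //; apply: cvxK; [exact: ZK|exact: ZK|lra|lra].
Qed.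

(** * The radially rescaled map [g] and its envelope *)

Section RadialRescaling.
Variables (R : realType) (X : completeNormedModType R) (K : set X).
Variables (Rad rho sg M : R) (T : X -> X) (w : X) (p : R -> R).
Hypotheses (coneK : is_cone K) (rho0 : 0 < rho) (rho_sg : rho < sg).
Hypotheses (sgRad : sg <= Rad) (Kw : K w) (w0 : `|w| != 0).
Hypotheses (cont_p : continuous p) (p_ge : forall s, rho <= p s).
Hypothesis p_le : forall s, p s <= sg.
Let D := cball (0 : X) Rad `&` K.
Hypothesis TK : forall x, D x -> K (T x).
Hypothesis TM : forall x, D x -> `|T x| <= M.
Hypothesis cT : compact (closure (T @` D)).

(** Off the origin, the point of norm [p] of the radius on the ray through [x]. It is 0 at the
    origin and discontinuous there, so the origin is treated apart. *)
Let u (x : X) := (p `|x| / `|x|) *: x.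
Let a (s : R) : R := Num.min s sg / p s.
Let lam (s : R) : R := Num.max 0 (rho - s).
Let g (x : X) := a `|x| *: T (u x) + lam `|x| *: w.

Let sg0 : 0 < sg. Proof. exact: lt_trans rho_sg. Qed.

Let p_gt0 s : 0 < p s. Proof. exact: lt_le_trans (p_ge s). Qed.

Let norm_u x : x != 0 -> `|u x| = p `|x|.
Proof.
move=> x0; rewrite /u normrZ ger0_norm; last by rewrite divr_ge0 // ltW.
by rewrite divfK // normr_eq0.
Qed.

Let Du x : K x -> D (u x).
Proof.
case: coneK => _ _ ZK _ Kx; split; last first.
  by apply: ZK => //; rewrite divr_ge0 // ltW.
rewrite /cball /= subr0; have [->|x0] := eqVneq x 0.
  by rewrite /u scaler0 normr0 (le_trans _ sgRad) // ltW.
by rewrite norm_u // (le_trans (p_le _)).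
Qed.

Let M0 : 0 <= M.
Proof. by apply: le_trans (normr_ge0 (T (u w))) (TM _); exact: Du. Qed.

Let a_ge0 s : 0 <= s -> 0 <= a s.
Proof.
by move=> s0; rewrite divr_ge0 ?(ltW (p_gt0 _)) // le_min s0 ltW.
Qed.

Let a_le s : a s <= sg / rho.
Proof.
rewrite ler_pdivrMr //; apply: (@le_trans _ _ sg); first by rewrite ge_min lexx orbT.
rewrite mulrAC ler_pdivlMr //; by apply: ler_wpM2l => //; exact: ltW.
Qed.

(** This makes the term with [T] vanish at the origin in spite of the discontinuity of [u]. *)
Let a_le_div s : 0 <= s -> a s <= s / rho.
Proof.
move=> s0; apply: (@le_trans _ _ (s / p s)).
  by rewrite ler_pM2r ?invr_gt0 // ge_min lexx.
by apply: ler_wpM2l => //; rewrite lef_pV2 ?posrE.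
Qed.

Let C := (fun z : R * X * R => z.1.1 *: z.1.2 + z.2 *: w) @`
  ((`[0, sg / rho]%classic `*` closure (T @` D)) `*` `[0, rho]%classic).

Let cC : compact C.
Proof.
apply: continuous_compact; last first.
  by do 2?apply: compact_setX => //; exact: segment_compact.
apply: continuous_subspaceT => -[[s y] l].
have c1 : (fun z : R * X * R => z.1) @ (s, y, l) --> (s, y) by exact: cvg_fst.
have c2 : (fun z : R * X * R => z.2) @ (s, y, l) --> l by exact: cvg_snd.
have c11 : (fun z : R * X => z.1) @ (s, y) --> s by exact: cvg_fst.
have c12 : (fun z : R * X => z.2) @ (s, y) --> y by exact: cvg_snd.
exact: (cvgD (cvgZ (cvg_comp _ _ c1 c11) (cvg_comp _ _ c1 c12)) (cvgZr_tmp c2)).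
Qed.

Let CK : C `<=` K.
Proof.
move=> _ [[[s y] l] [[/= s01 yT] l01] <-] /=.
move: s01 l01; rewrite /= !in_itv /= => /andP[s0 _] /andP[l0 _].
apply: cone_comb => //; case: coneK => clK _ _ _.
apply: clK => B /yT[z [[v Dv <-] Bz]]; exists (T v); split => //; exact: TK.
Qed.

Let gC x : K x -> C (g x).
Proof.
move=> Kx; exists (a `|x|, T (u x), lam `|x|) => //; split; [split|] => /=.
- by rewrite in_itv /= a_ge0 // a_le.
- by apply: subset_closure; exists (u x) => //; exact: Du.
- by rewrite in_itv /= le_max lexx /= ge_max (ltW rho0) gerBl normr_ge0.
Qed.

Let KclC x : clco C x -> K x.
Proof. by case: coneK => clK cvxK _ _; exact: clco_min. Qed.

Let norm_continuous_comp (f : R -> R) (x : X) :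
  continuous f -> (fun y : X => f `|y|) @ x --> f `|x|.
Proof.
move=> cf; exact: (cvg_comp _ _ (@norm_continuous R X x) (cf `|x|)).
Qed.

Let cont_a : continuous a.
Proof.
move=> s; have ps : p s != 0 by rewrite gt_eqF.
have c1 : (fun s : R => Num.min s sg) @ s --> Num.min s sg.
  by apply: (@continuous_min R _ id (cst sg)); [exact: cvg_id|exact: cvg_cst].
exact: (cvgM c1 (cvgV ps (@cont_p s))).
Qed.

Let cont_lam : continuous lam.
Proof.
move=> s; apply: (@continuous_max R _ (cst 0) (fun s => rho - s)).
  exact: cvg_cst.
exact: (cvgB (cvg_cst rho) cvg_id).
Qed.

Let cont_u x : x != 0 -> u @ x --> u x.
Proof.
move=> x0; have nx0 : `|x| != 0 by rewrite normr_eq0.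
have cn := @norm_continuous R X x.
exact: (cvgZ (cvgM (norm_continuous_comp (x := x) (@cont_p)) (cvgV nx0 cn)) cvg_id).
Qed.

(** As [y] tends to 0, the bounded values of [T] are damped by [a] and [lam] tends to [rho]; the
    envelope of [g] at 0 is thus contained in the singleton of [rho *: w]. *)
Let near_g_zero d : 0 < d ->
  \forall y \near (0 : X), clco C y -> thicken [set rho *: w] d (g y).
Proof.
move=> d0; pose B := M / rho + `|w| + 1.
have B0 : 0 < B.
  by rewrite ltr_wpDl // addr_ge0 // divr_ge0 // ltW.
apply/nbhs_ballP; exists (d / B) => /=; first by rewrite divr_gt0.
move=> y; rewrite -ball_normE /= sub0r normrN ltr_pdivlMr // => yd /KclC Ky e de.
exists (rho *: w) => //; apply: lt_trans de; apply: le_lt_trans yd.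
have -> : g y - rho *: w = a `|y| *: T (u y) + (lam `|y| - rho) *: w.
  by rewrite scalerBl addrA.
apply: le_trans (ler_normD _ _) _.
rewrite (normrZ (a `|y|)) (normrZ (lam `|y| - rho)).
have aM : `|a `|y| | * `|T (u y)| <= `|y| / rho * M.
  apply: ler_pM => //; last exact/TM/Du.
  by rewrite ger0_norm ?a_ge0 ?a_le_div.
have lw : `|lam `|y| - rho| * `|w| <= `|y| * `|w|.
  apply: ler_wpM2r => //; rewrite /lam ler_norml.
  by have := normr_ge0 y; have := rho0; case: (leP 0 (rho - `|y|)); lra.
have y0 := normr_ge0 y.
have -> : `|y| * B = `|y| / rho * M + `|y| * `|w| + `|y|.
  by rewrite /B; field; rewrite gt_eqF.
by apply: le_trans (lerD aM lw) _; rewrite lerDl.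
Qed.

(** Off the origin [u], [a] and [lam] are continuous, so the coefficients of [g y] can be frozen at
    [x]. The target set is the preimage of a closed hull under the affine map that solves for the
    value of [T]. *)
Let near_g x d e : x != 0 -> 0 < d -> 0 < e ->
  \forall y \near x, clco C y ->
    thicken [set z | clco (T @` (cball (u x) e `&` D))
                       ((a `|x|)^-1 *: (z - lam `|x| *: w))] d (g y).
Proof.
move=> x0 d0 e0; have ax : a `|x| != 0.
  by rewrite gt_eqF // divr_gt0 // lt_min normr_gt0 x0 sg0.
(* A bound on the error made by freezing the coefficients. *)
pose q (y : X) := `|a `|y| - a `|x| | * M + `|lam `|y| - lam `|x| | * `|w|.
have cq : q @ x --> q x.
  have c1 : (fun y : X => `|a `|y| - a `|x| |) @ x --> `|a `|x| - a `|x| |.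
    exact: (cvg_norm (cvgB (norm_continuous_comp (@cont_a)) (cvg_cst _))).
  have c2 : (fun y : X => `|lam `|y| - lam `|x| |) @ x --> `|lam `|x| - lam `|x| |.
    exact: (cvg_norm (cvgB (norm_continuous_comp (@cont_lam)) (cvg_cst _))).
  exact: (cvgD (cvgM c1 (cvg_cst M)) (cvgM c2 (cvg_cst `|w|))).
have qx : q x < d by rewrite /q !subrr !normr0 !mul0r addr0.
have near_q : \forall y \near x, q y < d by exact: (cq _ (lt_nbhsl qx)).
have near_u : \forall y \near x, ball (u x) e (u y).
  exact: (cont_u x0 (nbhsx_ballx _ _ e0)).
near=> y => /KclC Ky f df.
exists (a `|x| *: T (u y) + lam `|x| *: w).
  rewrite /= addrK scalerA mulVf // scale1r; apply: sub_clco.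
  exists (u y) => //; split; last exact: Du.
  have : ball (u x) e (u y) by near: y.
  by rewrite -ball_normE /cball /= distrC => /ltW.
apply: lt_trans df; apply: (@le_lt_trans _ _ (q y)); last by near: y.
have -> : g y - (a `|x| *: T (u y) + lam `|x| *: w)
        = (a `|y| - a `|x|) *: T (u y) + (lam `|y| - lam `|x|) *: w.
  by rewrite /g !scalerBl opprD addrACA.
apply: le_trans (ler_normD _ _) _.
rewrite (normrZ (a `|y| - _)) (normrZ (lam `|y| - _)) lerD2r.
by apply: ler_wpM2l => //; exact/TM/Du.
Unshelve. all: by end_near. Qed.

(** The origin is excluded because [rho *: w] is nonzero; elsewhere [near_g] transfers the envelope
    of [g] at [x] to that of [T] at [u x]. *)
Lemma rescaled_fixpoint : exists x, [/\ K x, x != 0 &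
  envelope K Rad T ((p `|x| / `|x|) *: x)
    ((Num.min `|x| sg / p `|x|)^-1 *: (x - Num.max 0 (rho - `|x|) *: w))].
Proof.
have C0 : C !=set0 by exists (g w); exact: gC.
have [x Cx xg] := clco_envelope_fixpoint cC C0 (fun x Cx => gC (KclC Cx)).
have Kx := KclC Cx; have x0 : x != 0.
  apply/eqP => x0; rewrite x0 in xg.
  have : [set rho *: w] (0 : X).
    apply: closed_convex_envelope_sub near_g_zero xg.
      exact/accessible_closed_set1/hausdorff_accessible/norm_hausdorff.
    by move=> _ _ t -> -> _ _; rewrite -scalerDl addrC subrK scale1r.
  move/esym/eqP; rewrite scaler_eq0 gt_eqF //= => /eqP wE.
  by move: w0; rewrite wE normr0 eqxx.
exists x; split => // e e0.
apply: (closed_convex_envelope_sub _ _ (fun d d0 => near_g x0 d0 e0) xg).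
  have : continuous (fun z => (a `|x|)^-1 *: (z - lam `|x| *: w)).
    by move=> z; exact: (cvgZl_tmp (cvgB cvg_id (cvg_cst _))).
  move/continuous_closedP => /(_ _ (@closed_clco _ _ (T @` (cball (u x) e `&` D)))).
  exact.
move=> y z t /= yE zE t0 t1.
set v := lam `|x| *: w in yE zE *; set b := (a `|x|)^-1 in yE zE *.
have -> : b *: (t *: y + (1 - t) *: z - v)
        = t *: (b *: (y - v)) + (1 - t) *: (b *: (z - v)).
  rewrite !scalerA ![_ * b]mulrC -!scalerA -scalerDr; congr (_ *: _).
  by rewrite (scalerBr t) (scalerBr (1 - t)) addrACA -opprD
    -scalerDl (addrC t) subrK scale1r.
exact: convex_clco.
Qed.

End RadialRescaling.

End Analysis.

(** * The three ranges of the radius of the fixed point *)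

Local Open Scope classical_set_scope.
Local Open Scope ring_scope.

Theorem theorem3 (R : realType) (X : completeNormedModType R) (K : set X)
  (r1 r2 Rad : R) (T : X -> X) :
  is_cone K ->
  0 < r1 -> 0 < r2 -> 0 < Rad -> r1 <= Rad -> r2 <= Rad -> r1 != r2 ->
  (forall x, (cball 0 Rad `&` K) x -> K (T x)) ->
  compact (closure (T @` (cball 0 Rad `&` K))) ->
  (forall x, (cball 0 Rad `&` K) x -> envelope K Rad T x x -> x = T x) ->
  (forall x, K x -> `|x| = r1 -> forall l : R, 1 <= l ->
      ~ envelope K Rad T x (l *: x)) ->
  (exists w, [/\ K w, `|w| != 0 &
      forall (l : R) x, 0 <= l -> K x -> `|x| = r2 ->
        ~ (exists2 y, envelope K Rad T x y & x = y + l *: w)]) ->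
  exists x, [/\ K x, T x = x, Num.min r1 r2 < `|x| & `|x| < Num.max r1 r2].
Proof.
move=> coneK r10 r20 Rad0 r1Rad r2Rad r12 TK cT fixT condA [w [Kw w0 condB]].
have [p [cont_p p_lo p_hi p_in p_bd]] := radius_profile r12.
set rho := Num.min r1 r2 in p_lo p_in p_bd *.
set sg := Num.max r1 r2 in p_hi p_in p_bd *.
have rho0 : 0 < rho by rewrite lt_min r10.
have rho_sg : rho < sg.
  by rewrite /rho /sg; case: (ltgtP r1 r2) r12.
have sgRad : sg <= Rad by rewrite ge_max r1Rad.
have [M TM] : exists M, forall x, (cball 0 Rad `&` K) x -> `|T x| <= M.
  have [N [_ TN]] := compact_bounded cT.
  exists (N + 1) => x Dx; apply: TN; first by rewrite ltrDl.
  by apply: subset_closure; exists x.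
have p_ge s : rho <= p s by case/andP: (p_bd s).
have p_le s : p s <= sg by case/andP: (p_bd s).
have [x [Kx x0 envx]] :=
  rescaled_fixpoint coneK rho0 rho_sg sgRad Kw w0 cont_p p_ge p_le TK TM cT.
case: (coneK) => _ _ ZK _.
have nx : 0 < `|x| by rewrite normr_gt0.
have p0 : 0 < p `|x| by exact: lt_le_trans (p_ge _).
set u := (p `|x| / `|x|) *: x in envx.
have Ku : K u by apply: ZK => //; rewrite divr_ge0 // ltW.
have nu : `|u| = p `|x|.
  by rewrite /u normrZ ger0_norm ?divfK ?gt_eqF // divr_ge0 // ltW.
have Du : (cball 0 Rad `&` K) u.
  by split => //; rewrite /cball /= subr0 nu (le_trans (p_le _)).
have [xrho|rhox] := leP `|x| rho.
  have xsg : `|x| <= sg by exact: le_trans xrho (ltW rho_sg).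
  have pE := p_lo _ xrho.
  (* Here [p] equals [r2], and [x] is [|x| / r2] times a point of the envelope plus [rho - |x|]
     times [w]; multiplying by [r2 / |x|] turns [x] into [u] and gives this factor of [w]. *)
  exfalso; apply: (condB ((rho - `|x|) * (r2 / `|x|)) u _ Ku).
  - by rewrite mulr_ge0 ?subr_ge0 // divr_ge0 // ltW.
  - by rewrite nu.
  - exists ((Num.min `|x| sg / p `|x|)^-1 *: (x - Num.max 0 (rho - `|x|) *: w)) => //.
    rewrite (min_idPl xsg) max_r ?subr_ge0 // pE invf_div /u pE.
    by rewrite scalerBr scalerA [_ * (rho - _)]mulrC subrK.
have lam0 : Num.max 0 (rho - `|x|) = 0 by rewrite max_l // subr_le0 ltW.
move: envx; rewrite lam0 scale0r subr0 => envx.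
have [sgx|xsg] := leP sg `|x|.
  have pE := p_hi _ sgx.
  (* Here [p] equals [r1], and the envelope point is [r1 / sg] times [x], that is [|x| / sg] times
     [u]. *)
  exfalso; apply: (condA u Ku _ (`|x| / sg)); first by rewrite nu.
    by rewrite ler_pdivlMr ?mul1r // (lt_trans rho0).
  move: envx; rewrite (min_idPr sgx) invf_div; congr (envelope _ _ _ _ _).
  rewrite /u scalerA pE; congr (_ *: _); field.
  by rewrite !gt_eqF // (lt_trans rho0).
have uE : u = T u.
  (* Between the radii the inverse coefficient is [p |x| / |x|], so the envelope point is [u]
     itself. *)
  apply: fixT => //; move: envx; rewrite (min_idPl (ltW xsg)) invf_div.
  by [].
by exists u; have /andP[? ?] := p_in _ rhox xsg; split; rewrite ?nu.
Qed.
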